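(* Let $\mathfrak{g}$ be one of $W(n)$, $S(n)$, $H(n)$. The category $\mathcal{LC}$ of Lie-Cartan modules for $\mathfrak{g}$ is abelian.
   Context: Ground field: $\mathbb{F}$ algebraically closed of characteristic $0$. $\mathcal{R}=\mathbb{F}[x_1,\dots,x_n]$, $\mathcal{R}_i$ = homogeneous polynomials of degree $i$, $\partial_i=\partial/\partial x_i$. $W(n)=\mathrm{Der}(\mathcal{R})=\bigoplus_i\mathcal{R}\partial_i$; $S(n)=\{\sum f_i\partial_i\in W(n):\sum_i\partial_i(f_i)=0\}$; for $n=2r$, $H(n)=\{D_H(f):f\in\mathcal{R}\}$, $D_H(f)=\sum_{i=1}^n\sigma(i)\partial_i(f)\partial_{i'}$, where $\sigma(i)=1,\ i'=i+r$ for $i\le r$ and $\sigma(i)=-1,\ i'=i-r$ for $i>r$. $\mathfrak{g}=\bigoplus_{i\ge-1}\mathfrak{g}_i$, where $\mathfrak{g}_i$ consists of the elements $\sum f_j\partial_j\in\mathfrak{g}$ with all $f_j\in\mathcal{R}_{i+1}$. $\mathfrak h=\mathfrak g_0\cap\mathrm{span}\{x_i\partial_i\}$ and $\mathsf{P}=\mathfrak{g}_{-1}\oplus\mathfrak{g}_0$. Category $\mathcal{O}$: objects are $\mathfrak{g}$-modules $M$ with (1) a grading $M=\bigoplus_{i\in\mathbb{Z}}M_i$, $\dim M_i<\infty$, $\mathfrak{g}_iM_j\subseteq M_{i+j}$; (2) $M$ locally finite as a $\mathsf{P}$-module; (3) $M$ is $\mathfrak{h}$-semisimple. Morphisms are grading-preserving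 $\mathfrak{g}$-homomorphisms. A Lie-Cartan module is an object $M\in\mathcal{O}$, with $\mathfrak{g}$-action $\rho$, which is also an $\mathcal{R}$-module with action $\theta$ such that $[\rho(X),\theta(f)]=\theta(X(f))$ for all $X\in\mathfrak{g}$, $f\in\mathcal{R}$, and $\theta(\mathcal{R}_i)M_j\subseteq M_{i+j}$. The category $\mathcal{LC}$ has Lie-Cartan modules as objects and $\mathcal{R}$-linear morphisms of $\mathcal{O}$ as morphisms. *)

(* Defs.v *)
From HB Require Import structures.
From mathcomp Require Import all_boot all_order all_algebra.
From mathcomp Require Import boolp mpoly.
Set Implicit Arguments.
Unset Strict Implicit.
Unset Printing Implicit Defensive.
Import GRing.Theory.
Local Open Scope ring_scope.

Record category := Category {
  obj :> Type;
  hom : obj -> obj -> Type;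
  idm : forall a, hom a a;
  comp : forall a b c, hom b c -> hom a b -> hom a c;
  comp1m : forall a b (f : hom a b), comp (idm b) f = f;
  compm1 : forall a b (f : hom a b), comp f (idm a) = f;
  compA : forall a b c d (h : hom c d) (g : hom b c) (f : hom a b),
    comp h (comp g f) = comp (comp h g) f }.

Arguments idm {c} a : rename.
Arguments comp {c a b c0} g f : rename.

Record preadditive (C : category) := Preadditive {
  hadd : forall a b : C, hom a b -> hom a b -> hom a b;
  hzero : forall a b : C, hom a b;
  hopp : forall a b : C, hom a b -> hom a b;
  haddA : forall (a b : C) (f g h : hom a b),
    hadd f (hadd g h) = hadd (hadd f g) h;
  haddC : forall (a b : C) (f g : hom a b), hadd f g = hadd g f;
  hadd0 : forall (a b : C) (f : hom a b), hadd (hzero a b) f = f;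
  haddN : forall (a b : C) (f : hom a b), hadd (hopp f) f = hzero a b;
  compDl : forall (a b c : C) (g h : hom b c) (f : hom a b),
    comp (hadd g h) f = hadd (comp g f) (comp h f);
  compDr : forall (a b c : C) (h : hom b c) (f g : hom a b),
    comp h (hadd f g) = hadd (comp h f) (comp h g) }.

Section Abelian.
Variables (C : category) (A : preadditive C).

Definition zero_object (z : C) : Prop :=
  forall a : C, (exists! f : hom a z, True) /\ (exists! f : hom z a, True).

Definition biproduct (a b p : C) (p1 : hom p a) (p2 : hom p b)
    (i1 : hom a p) (i2 : hom b p) : Prop :=
  [/\ comp p1 i1 = idm a, comp p2 i2 = idm b,
      comp p1 i2 = hzero A b a, comp p2 i1 = hzero A a b
    & hadd A (comp i1 p1) (comp i2 p2) = idm p].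

Definition mono (a b : C) (f : hom a b) : Prop :=
  forall (x : C) (g h : hom x a), comp f g = comp f h -> g = h.

Definition epi (a b : C) (f : hom a b) : Prop :=
  forall (x : C) (g h : hom b x), comp g f = comp h f -> g = h.

Definition is_kernel (a b : C) (f : hom a b) (k : C) (i : hom k a) : Prop :=
  comp f i = hzero A k b /\
  forall (x : C) (g : hom x a), comp f g = hzero A x b ->
    exists! u : hom x k, comp i u = g.

Definition is_cokernel (a b : C) (f : hom a b) (q : C) (p : hom b q) : Prop :=
  comp p f = hzero A a q /\
  forall (x : C) (g : hom b x), comp g f = hzero A a x ->
    exists! u : hom q x, comp u p = g.

Record abelian_structure : Prop := AbelianStructure {
  ab_zero : exists z : C, zero_object z;
  ab_biproduct : forall a b : C, exists (p : C) (p1 : hom p a) (p2 : hom p b)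
    (i1 : hom a p) (i2 : hom b p), biproduct p1 p2 i1 i2;
  ab_kernel : forall (a b : C) (f : hom a b),
    exists (k : C) (i : hom k a), is_kernel f i;
  ab_cokernel : forall (a b : C) (f : hom a b),
    exists (q : C) (p : hom b q), is_cokernel f p;
  ab_mono : forall (a b : C) (f : hom a b), mono f ->
    exists (c : C) (g : hom b c), is_kernel g f;
  ab_epi : forall (a b : C) (f : hom a b), epi f ->
    exists (c : C) (g : hom c a), is_cokernel g f }.

End Abelian.

(* The additive structure of an abelian category is unique, so being abelian is
   a property of the bare category. *)
Definition abelian_category (C : category) : Prop :=
  exists A : preadditive C, abelian_structure A.

(* The tuple X stands for the derivation \sum_i X i * d/dx_i. *)
Notation vfield F n := {ffun 'I_n -> {mpoly F[n]}}.

Section VectorFields.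
Variables (F : fieldType) (n : nat).
Implicit Types (X Y Z : vfield F n) (p q : {mpoly F[n]}).

Definition vapp X p : {mpoly F[n]} := \sum_(i < n) X i * p^`M(i).

Definition vbracket X Y : vfield F n := [ffun j => vapp X (Y j) - vapp Y (X j)].

Lemma vappM X p q : vapp X (p * q) = vapp X p * q + p * vapp X q.
Proof.
rewrite /vapp mulr_suml mulr_sumr -big_split /=; apply: eq_bigr => i _.
by rewrite mderivM mulrDr [X in X + _]mulrA; congr (_ + _); rewrite mulrCA.
Qed.

Lemma vapp_linearr X a p q : vapp X (a *: p + q) = a *: vapp X p + vapp X q.
Proof.
rewrite /vapp scaler_sumr -big_split /=; apply: eq_bigr => i _.
by rewrite mderivD mderivZ mulrDr scalerAr.
Qed.

Lemma vapp_linearl a X Y p : vapp (a *: X + Y) p = a *: vapp X p + vapp Y p.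
Proof.
rewrite /vapp scaler_sumr -big_split /=; apply: eq_bigr => i _.
by rewrite !ffunE mulrDl scalerAl.
Qed.

Lemma vapp_deriv X j p :
  (vapp X p)^`M(j) = vapp [ffun i => (X i)^`M(j)] p + vapp X p^`M(j).
Proof.
rewrite /vapp linear_sum -big_split /=; apply: eq_bigr => i _.
by rewrite mderivM ffunE mderiv_comm.
Qed.

Lemma vapp_sum X (I : Type) (r : seq I) (E : I -> {mpoly F[n]}) :
  vapp X (\sum_(i <- r) E i) = \sum_(i <- r) vapp X (E i).
Proof.
elim/big_rec2: _ => [|i p q _ <-].
  by rewrite /vapp big1 // => i _; rewrite linear0 mulr0.
by rewrite -[E i]scale1r vapp_linearr !scale1r.
Qed.

Lemma vbracketE X Y p :
  vapp (vbracket X Y) p = vapp X (vapp Y p) - vapp Y (vapp X p).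
Proof.
have E Z T : vapp Z (vapp T p) =
    \sum_(i < n) vapp Z (T i) * p^`M(i)
    + \sum_(i < n) \sum_(j < n) T i * Z j * (p^`M(i))^`M(j).
  rewrite {2}/vapp vapp_sum -big_split /=; apply: eq_bigr => i _.
  rewrite vappM; congr (_ + _).
  by rewrite /vapp mulr_sumr; apply: eq_bigr => j _; rewrite mulrA.
rewrite !E opprD addrACA [X in _ = _ + (X - _)]exchange_big -!sumrB /=.
rewrite [X in _ = _ + X]big1 ?addr0 => [|i _].
  by apply: eq_bigr => i _; rewrite ffunE mulrBl.
rewrite -sumrB big1 // => j _.
by rewrite mderiv_comm [Y j * _]mulrC subrr.
Qed.

Record lie_subalgebra := LieSubalgebra {
  lie_mem : {pred vfield F n};
  lie_submod : submod_closed lie_mem;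
  lie_vbracket : forall X Y,
    X \in lie_mem -> Y \in lie_mem -> vbracket X Y \in lie_mem }.

Fact W_submod : submod_closed (predT : {pred vfield F n}).
Proof. by []. Qed.

Definition W_alg : lie_subalgebra :=
  @LieSubalgebra predT W_submod (fun _ _ _ _ => isT).

Definition vdiv X : {mpoly F[n]} := \sum_(i < n) (X i)^`M(i).

Definition S_mem : {pred vfield F n} := [pred X | vdiv X == 0].

Lemma vdiv_linear a X Y : vdiv (a *: X + Y) = a *: vdiv X + vdiv Y.
Proof.
rewrite /vdiv scaler_sumr -big_split /=; apply: eq_bigr => i _.
by rewrite !ffunE mderivD mderivZ.
Qed.

Lemma vdiv_bracket X Y :
  vdiv (vbracket X Y) = vapp X (vdiv Y) - vapp Y (vdiv X).
Proof.
have E (Z T : vfield F n) : \sum_(j < n) (vapp Z (T j))^`M(j) =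
    \sum_(j < n) \sum_(i < n) (Z i)^`M(j) * (T j)^`M(i) + vapp Z (vdiv T).
  rewrite /vdiv vapp_sum -big_split /=; apply: eq_bigr => j _.
  rewrite vapp_deriv; congr (_ + _); rewrite /vapp.
  by apply: eq_bigr => i _; rewrite ffunE.
transitivity (\sum_(j < n) (vapp X (Y j))^`M(j)
              - \sum_(j < n) (vapp Y (X j))^`M(j)).
  by rewrite -sumrB; apply: eq_bigr => j _; rewrite ffunE mderivB.
rewrite !E exchange_big /= opprD addrACA -[RHS]add0r; congr (_ + _).
rewrite -sumrB big1 // => i _; rewrite -sumrB big1 // => j _.
by rewrite mulrC subrr.
Qed.

Fact S_submod : submod_closed S_mem.
Proof.
split=> [|a X Y]; rewrite !inE.
  by rewrite /vdiv big1 // => i _; rewrite ffunE mderiv0.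
by move=> /eqP hX /eqP hY; rewrite vdiv_linear hX hY scaler0 addr0.
Qed.

Fact S_bracket X Y : X \in S_mem -> Y \in S_mem -> vbracket X Y \in S_mem.
Proof.
rewrite !inE vdiv_bracket => /eqP -> /eqP ->; apply/eqP.
by rewrite /vapp !big1 ?subr0 // => i _; rewrite mderiv0 mulr0.
Qed.

Definition S_alg : lie_subalgebra := LieSubalgebra S_submod S_bracket.

(* p * d/dx_i *)
Definition vsingle p (i : 'I_n) : vfield F n :=
  [ffun j => if j == i then p else 0].

End VectorFields.

Section Hamiltonian.
Variables (F : fieldType) (r : nat).
Implicit Types (i : 'I_(r + r)) (f g : {mpoly F[r + r]}).

Definition hsigma i : F := if (i < r)%N then 1 else -1.

Definition hconj i : 'I_(r + r) :=
  match split i with inl j => rshift r j | inr j => lshift r j end.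

(* i.e. \sum_i hsigma i * (df/dx_i) d/dx_(hconj i), in n = 2r = r + r variables *)
Definition DH f : vfield F (r + r) :=
  \sum_(i < r + r) vsingle (hsigma i *: f^`M(i)) (hconj i).

Definition H_mem : {pred vfield F (r + r)} :=
  [pred X | `[< exists f, X = DH f >]].

Lemma hconjK : involutive hconj.
Proof.
move=> i; rewrite {2}/hconj; case: splitP => j ij.
  by rewrite /hconj (unsplitK (inr j)); apply: val_inj.
by rewrite /hconj (unsplitK (inl j)); apply: val_inj.
Qed.

Lemma hsigma_conj i : hsigma (hconj i) = - hsigma i.
Proof.
rewrite /hsigma /hconj; case: (fintype.splitP i) => j /= ij; rewrite ?ij /=.
  by rewrite ltnNge leq_addr.
by rewrite ltn_ord opprK.
Qed.

Lemma DH_conj f i : DH f (hconj i) = hsigma i *: f^`M(i).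
Proof.
rewrite /DH sum_ffunE (bigD1 i) //= ffunE eqxx big1 ?addr0 // => j ji.
by rewrite ffunE (inj_eq (inv_inj hconjK)) eq_sym (negPf ji).
Qed.

Lemma DH_linear a f g : DH (a *: f + g) = a *: DH f + DH g.
Proof.
apply/ffunP => j; rewrite -[j]hconjK !ffunE !DH_conj mderivD mderivZ.
by rewrite scalerDr !scalerA mulrC.
Qed.

Lemma DH_app f g :
  vapp (DH f) g = \sum_(i < r + r) hsigma i *: (f^`M(i) * g^`M(hconj i)).
Proof.
rewrite /vapp (reindex_inj (inv_inj hconjK)) /=; apply: eq_bigr => i _.
by rewrite DH_conj scalerAl.
Qed.

Lemma DH_appC f g : vapp (DH f) g = - vapp (DH g) f.
Proof.
rewrite !DH_app (reindex_inj (inv_inj hconjK)) -sumrN /=.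
apply: eq_bigr => i _.
by rewrite hsigma_conj hconjK scaleNr mulrC.
Qed.

Lemma DH_bracket f g : vbracket (DH f) (DH g) = DH (vapp (DH f) g).
Proof.
apply/ffunP => j; rewrite -[j]hconjK; set i := hconj j.
rewrite ffunE !DH_conj vapp_deriv.
have vZ X a p : vapp X (a *: p) = a *: vapp X p :> {mpoly F[r + r]}.
  have v0 : vapp X 0 = 0.
    by rewrite /vapp big1 // => k _; rewrite mderiv0 mulr0.
  by rewrite -[a *: p]addr0 vapp_linearr v0 addr0.
have -> : [ffun k => (DH f k)^`M(i)] = DH f^`M(i).
  apply/ffunP => k; rewrite -[k]hconjK ffunE !DH_conj mderivZ.
  by rewrite mderiv_comm.
by rewrite !vZ [vapp (DH f^`M(i)) g]DH_appC scalerDr scalerN addrC.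
Qed.

Fact H_submod : submod_closed H_mem.
Proof.
split=> [|a X Y].
  rewrite inE; apply/asboolP; exists 0; apply/ffunP => j.
  by rewrite -[j]hconjK DH_conj mderiv0 scaler0 ffunE.
rewrite !inE => /asboolP[f ->] /asboolP[g ->]; apply/asboolP.
by exists (a *: f + g); rewrite DH_linear.
Qed.

Fact H_bracket X Y : X \in H_mem -> Y \in H_mem -> vbracket X Y \in H_mem.
Proof.
rewrite !inE => /asboolP[f ->] /asboolP[g ->]; apply/asboolP.
by exists (vapp (DH f) g); rewrite DH_bracket.
Qed.

Definition H_alg : lie_subalgebra F (r + r) := LieSubalgebra H_submod H_bracket.

End Hamiltonian.

Section LieElements.
Variables (F : fieldType) (n : nat) (g : lie_subalgebra F n).

Record lie_elt := LieElt { lie_val : vfield F n; _ : lie_val \in lie_mem g }.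

HB.instance Definition _ :=
  GRing.isSubmodClosed.Build F (vfield F n) (lie_mem g) (lie_submod g).
HB.instance Definition _ := [isSub for lie_val].
HB.instance Definition _ := [Choice of lie_elt by <:].
HB.instance Definition _ := [SubChoice_isSubLmodule of lie_elt by <:].

Lemma lie_valP (X : lie_elt) : lie_val X \in lie_mem g.
Proof. exact: valP. Qed.

Definition lbracket (X Y : lie_elt) : lie_elt :=
  LieElt (lie_vbracket (lie_valP X) (lie_valP Y)).

(* The graded piece g_d; it is zero for d < -1. *)
Definition lie_deg (d : int) (X : lie_elt) : Prop :=
  if (d + 1)%R is Posz k then forall j, lie_val X j \is k.-homog
  else X = 0.

Definition in_P (X : lie_elt) : Prop :=
  exists Y Z : lie_elt, [/\ lie_deg (-1) Y, lie_deg 0 Z & X = Y + Z].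

Definition in_h (X : lie_elt) : Prop :=
  lie_deg 0 X /\
  exists a : 'I_n -> F, lie_val X = \sum_(i < n) vsingle (a i *: 'X_i) i.

End LieElements.

Section Spaces.
Variables (F : fieldType) (V : lmodType F).
Implicit Types P : V -> Prop.

Definition subspace P : Prop :=
  P 0 /\ forall (a : F) (u v : V), P u -> P v -> P (a *: u + v).

Definition fin_dim P : Prop :=
  exists b : seq V, forall v : V,
    P v <-> exists c : nat -> F, v = \sum_(i < size b) c i *: b`_i.

Definition direct_sum (M_ : int -> V -> Prop) : Prop :=
  [/\ forall i, subspace (M_ i),
      forall v : V, exists (s : seq int) (c : int -> V),
        (forall i, M_ i (c i)) /\ v = \sum_(i <- s) c i
    & forall (s : seq int) (c : int -> V), uniq s -> (forall i, M_ i (c i)) ->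
        \sum_(i <- s) c i = 0 -> forall i, i \in s -> c i = 0].

End Spaces.

Section CategoryO.
Variables (F : fieldType) (n : nat) (g : lie_subalgebra F n).

Definition lie_action (V : lmodType F) (rho : lie_elt g -> V -> V) : Prop :=
  [/\ forall a X Y v, rho (a *: X + Y) v = a *: rho X v + rho Y v,
      forall X a u v, rho X (a *: u + v) = a *: rho X u + rho X v
    & forall X Y v, rho (lbracket X Y) v = rho X (rho Y v) - rho Y (rho X v)].

Definition locally_finite (V : lmodType F) (rho : lie_elt g -> V -> V) : Prop :=
  forall v : V, exists U : V -> Prop,
    [/\ U v, fin_dim U & forall X u, in_P X -> U u -> U (rho X u)].

Definition h_weight (lam : lie_elt g -> F) : Prop :=
  forall a X Y, in_h X -> in_h Y -> lam (a *: X + Y) = a * lam X + lam Y.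

Definition weight_space (V : lmodType F) (rho : lie_elt g -> V -> V)
    (lam : lie_elt g -> F) (v : V) : Prop :=
  forall X, in_h X -> rho X v = lam X *: v.

(* V is the sum of its weight spaces for h; this sum is always direct. *)
Definition h_semisimple (V : lmodType F) (rho : lie_elt g -> V -> V) : Prop :=
  forall v : V, exists s : seq V, v = \sum_(w <- s) w /\
    forall w, w \in s -> exists2 lam, h_weight lam & weight_space rho lam w.

Record Omodule := OModule {
  O_car :> lmodType F;
  rho : lie_elt g -> O_car -> O_car;
  grade : int -> O_car -> Prop;
  O_action : lie_action rho;
  O_graded : direct_sum grade;
  O_fin : forall i, fin_dim (grade i);
  O_degree : forall i j X v,
    lie_deg i X -> grade j v -> grade (i + j) (rho X v);
  O_locfin : locally_finite rho;
  O_ss : h_semisimple rho }.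

Definition O_morphism (M N : Omodule) (f : M -> N) : Prop :=
  [/\ linear f, forall i v, grade i v -> grade i (f v)
    & forall X v, f (rho X v) = rho X (f v)].

Definition poly_action (V : lmodType F) (theta : {mpoly F[n]} -> V -> V) :
    Prop :=
  [/\ forall a p q v, theta (a *: p + q) v = a *: theta p v + theta q v,
      forall p a u v, theta p (a *: u + v) = a *: theta p u + theta p v,
      forall v, theta 1 v = v
    & forall p q v, theta (p * q) v = theta p (theta q v)].

Record LCmodule := LCModule {
  LC_O :> Omodule;
  theta : {mpoly F[n]} -> LC_O -> LC_O;
  LC_action : poly_action theta;
  LC_compat : forall X p v,
    rho X (theta p v) - theta p (rho X v) = theta (vapp (lie_val X) p) v;
  LC_degree : forall (i : nat) j p v,
    p \is i.-homog -> grade j v -> grade (i%:Z + j) (theta p v) }.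

Record LChom (M N : LCmodule) := LCHom {
  LC_fun :> M -> N;
  LC_fun_O : O_morphism LC_fun;
  LC_fun_theta : forall p v, LC_fun (theta p v) = theta p (LC_fun v) }.

Lemma LChom_eq (M N : LCmodule) (f f' : LChom M N) : f =1 f' -> f = f'.
Proof.
case: f f' => [f fO ft] [f' fO' ft'] /= /funext ff'; subst f'.
by congr LCHom; exact: Prop_irrelevance.
Qed.

Fact LCid_subproof (M : LCmodule) : O_morphism (@id M).
Proof. by []. Qed.

Definition LCid (M : LCmodule) : LChom M M :=
  LCHom (LCid_subproof M) (fun _ _ => erefl).

Fact LCcomp_O (M N K : LCmodule) (f : LChom N K) (f' : LChom M N) :
  O_morphism (f \o f').
Proof.
case: f f' => [f [fl fg fr] ft] [f' [fl' fg' fr'] ft'] /=.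
split=> [a u v|i v|X v] /=; first by rewrite fl' fl.
  by move=> /fg'/fg.
by rewrite fr' fr.
Qed.

Fact LCcomp_theta (M N K : LCmodule) (f : LChom N K) (f' : LChom M N) p v :
  (f \o f') (theta p v) = theta p ((f \o f') v).
Proof. by rewrite /= !LC_fun_theta. Qed.

Definition LCcomp (M N K : LCmodule) (f : LChom N K) (f' : LChom M N) :
    LChom M K :=
  LCHom (LCcomp_O f f') (LCcomp_theta f f').

Fact LCcomp1m (M N : LCmodule) (f : LChom M N) : LCcomp (LCid N) f = f.
Proof. exact: LChom_eq. Qed.

Fact LCcompm1 (M N : LCmodule) (f : LChom M N) : LCcomp f (LCid M) = f.
Proof. exact: LChom_eq. Qed.

Fact LCcompA (M N K L : LCmodule) (h : LChom K L) (f : LChom N K)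
    (f' : LChom M N) :
  LCcomp h (LCcomp f f') = LCcomp (LCcomp h f) f'.
Proof. exact: LChom_eq. Qed.

Definition LC : category := Category LCcomp1m LCcompm1 LCcompA.

End CategoryO.

(* Main.v *)
(* LC is abelian over any field and for any Lie algebra of polynomial vector
   fields: kernels, cokernels and products are those of the underlying vector
   spaces. The one axiom of category O that does not pass to submodules for
   formal reasons is h-semisimplicity: if a sum of weight vectors lies in an
   h-stable subspace, then so does its part of each weight, since a polynomial
   in the operators of h projects the finitely many weights involved onto any
   one of them. *)

Require Import Defs.
From HB Require Import structures.
From mathcomp Require Import all_boot all_order all_algebra.
From mathcomp Require Import boolp mpoly.
Set Implicit Arguments.
Unset Strict Implicit.
Unset Printing Implicit Defensive.
Import GRing.Theory.
Local Open Scope ring_scope.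

(** Besides weights, the grading shapes the argument. A map induced on a kernel or out of a cokernel
    is linear and equivariant for formal reasons, but it must also preserve degrees. This holds
    because a degree-preserving map is strict: if [f u] is homogeneous of degree [i], then the
    degree [i] component of [u] already maps to [f u]. Strictness also makes images graded, which
    lets quotients by them inherit a direct sum decomposition. Finite dimension needs an exchange
    argument, because [fin_dim] asks for a list that spans the subspace exactly, while a spanning
    list of a larger space may lie outside it. Submodules and quotients are handled only through an
    injective or surjective linear map. Operators on the new space come from choice, and each axiom
    is checked after applying the injection, or on values of the surjection. *)

Lemma linear_packed (F : fieldType) (U V : lmodType F) (f : U -> V) :
  linear f -> exists g : {linear U -> V}, f = g.
Proof.
move=> lf; pose g : {linear U -> V} := HB.pack f (GRing.isLinear.Build F U V _ f lf).
by exists g.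
Qed.

(** * Subspaces and finite dimension *)

Section Subspaces.
Variables (F : fieldType) (V : lmodType F).
Implicit Types (P Q : V -> Prop) (b : seq V).

Lemma subspaceD P u v : subspace P -> P u -> P v -> P (u + v).
Proof. by move=> [_ PD] Pu Pv; rewrite -[u]scale1r; apply: PD. Qed.

Lemma subspaceZ P a v : subspace P -> P v -> P (a *: v).
Proof. by move=> [P0 PD] Pv; rewrite -[a *: v]addr0; apply: PD. Qed.

Lemma subspaceB P u v : subspace P -> P u -> P v -> P (u - v).
Proof.
by move=> sP Pu Pv; apply: subspaceD => //; rewrite -scaleN1r; apply: subspaceZ.
Qed.

Lemma subspace_cap P Q : subspace P -> subspace Q ->
  subspace (fun v => P v /\ Q v).
Proof.
move=> [P0 PD] [Q0 QD]; split=> // a u v [Pu Qu] [Pv Qv].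
by split; [apply: PD|apply: QD].
Qed.

Definition span b : V -> Prop :=
  fun v => exists c : nat -> F, v = \sum_(i < size b) c i *: b`_i.

Lemma span_nil v : span [::] v <-> v = 0.
Proof.
by split=> [[c]|->]; rewrite ?big_ord0 //; exists (fun=> 0); rewrite big_ord0.
Qed.

Lemma span_cons x b v :
  span (x :: b) v <-> exists a, span b (v - a *: x).
Proof.
split=> [[c ->]|[a [c vE]]].
  exists (c 0%N), (fun i => c i.+1).
  by rewrite big_ord_recl /= addrC addKr; apply: eq_bigr.
exists (fun i => if i is j.+1 then c j else a).
by rewrite big_ord_recl /= -vE addrC subrK.
Qed.

Lemma span_linear b : subspace (span b).
Proof.
elim: b => [|x b [IH0 IHD]].
  split=> [|a u v]; first exact/span_nil.
  by move=> /span_nil-> /span_nil->; apply/span_nil; rewrite scaler0 addr0.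
split=> [|a u v /span_cons[cu Hu] /span_cons[cv Hv]]; apply/span_cons.
  by exists 0; rewrite scale0r subr0.
exists (a * cu + cv); rewrite scalerDl -scalerA opprD addrACA -scalerBr.
exact: IHD.
Qed.

(** Induction on a list [x :: b] whose span contains [P]: the part of [P] inside [span b] has
    codimension at most one in [P], so its spanning list needs at most one more vector. *)
Lemma fin_dim_sub P Q : fin_dim Q -> subspace P -> (forall v, P v -> Q v) ->
  fin_dim P.
Proof.
move=> [b bQ] sP PQ; have {bQ PQ}: forall v, P v -> span b v by move=> v /PQ/bQ.
elim: b P sP => [|x b IH] P sP Pb.
  exists [::] => v; split=> [/Pb //|/span_nil ->]; by case: sP.
have [b' b'P] := IH _ (subspace_cap sP (span_linear b)) (fun v => @proj2 _ _).
(* A vector of [P] outside [span b] has a nonzero coefficient [a] at [x], so it can serve as the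
   additional generator. *)
have [[v [Pv nbv]]|/forallNP nex] :=
  pselect (exists v, P v /\ ~ span b v); last first.
  exists b' => v; split=> [Pv|/b'P[]//]; apply/b'P; split=> //.
  by apply: contrapT => nbv; apply: (nex v).
have /span_cons[a av] := Pb v Pv.
have a0 : a != 0.
  by apply: contra_notN nbv => /eqP a0; move: av; rewrite a0 scale0r subr0.
exists (v :: b') => u; split=> [Pu|/span_cons[c /b'P[Pu _]]]; last first.
  by rewrite -[u](subrK (c *: v)); apply: subspaceD => //; apply: subspaceZ.
have /span_cons[c cu] := Pb u Pu.
apply/span_cons; exists (c / a); apply/b'P; split.
  by apply: subspaceB => //; apply: subspaceZ.
(* With the factor [c / a] the multiples of [x] cancel and the difference falls into [span b]. *)
have -> : u - (c / a) *: v = (u - c *: x) - (c / a) *: (v - a *: x).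
  by rewrite scalerBr scalerA divfK // opprB addrA subrK.
by apply: subspaceB (span_linear b) _ _ => //; apply: subspaceZ (span_linear b) _.
Qed.

End Subspaces.

Section LinearImages.
Variables (F : fieldType) (U V : lmodType F) (f : {linear U -> V}).

Lemma subspace_preim (P : V -> Prop) : subspace P -> subspace (fun u => P (f u)).
Proof.
move=> [P0 PD]; split=> [|a u v Pu Pv]; first by rewrite linear0.
by rewrite linearP; apply: PD.
Qed.

Lemma subspace_im (P : U -> Prop) :
  subspace P -> subspace (fun v => exists2 u, P u & f u = v).
Proof.
move=> [P0 PD]; split=> [|a _ _ [u Pu <-] [v Pv <-]].
  by exists 0 => //; rewrite linear0.
by exists (a *: u + v); [apply: PD|rewrite linearP].
Qed.

Lemma span_map b v : span [seq f x | x <- b] v <-> exists2 u, span b u & f u = v.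
Proof.
elim: b v => [|x b IH] v /=.
  split=> [/span_nil ->|[u /span_nil -> <-]]; last first.
    by apply/span_nil; rewrite linear0.
  by exists 0; rewrite ?linear0 //; apply/span_nil.
split=> [/span_cons[a /IH[u bu fu]]|[u /span_cons[a bu] <-]].
  exists (a *: x + u); first by apply/span_cons; exists a; rewrite addrC addKr.
  by rewrite linearP fu addrC subrK.
apply/span_cons; exists a; apply/IH; exists (u - a *: x) => //.
by rewrite linearB linearZ.
Qed.

Lemma fin_dim_im (P : U -> Prop) :
  fin_dim P -> fin_dim (fun v => exists2 u, P u & f u = v).
Proof.
move=> [b bP]; exists [seq f x | x <- b] => v; split.
  by move=> [u /bP bu fu]; apply/span_map; exists u.
by move=> /span_map[u bu fu]; exists u => //; apply/bP.
Qed.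

(** [P] may exceed the range of [f], so a spanning list is first found for the part of [P] inside
    the range; its members then have preimages. *)
Lemma fin_dim_preim (P : V -> Prop) :
  injective f -> subspace P -> fin_dim P -> fin_dim (fun u => P (f u)).
Proof.
move=> injf sP fP; have [||b bP] := @fin_dim_sub _ _
    (fun v => exists2 u, P (f u) & f u = v) _ fP.
- exact/subspace_im/subspace_preim.
- by move=> _ [u Pu <-].
have [b' b'E] : exists b', b = [seq f x | x <- b'].
  have : forall x, x \in b -> exists u, f u = x.
    move=> x xb; have [|u _ fu] := (bP x).2; last by exists u.
    (* A generator lies in its own span: the coefficients are the indicator of its first
       occurrence. *)
    exists (fun i => (i == index x b)%:R).
    have lt : (index x b < size b)%N by rewrite index_mem.
    rewrite (bigD1 (Ordinal lt)) //= eqxx scale1r nth_index // big1 ?addr0 //.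
    by move=> i; rewrite -val_eqE /= => /negPf->; rewrite scale0r.
  elim: b {bP} => [|x b IH] fb; first by exists [::].
  have [|b' ->] := IH; first by move=> y yb; apply: fb; rewrite inE yb orbT.
  have [u <-] := fb x (mem_head _ _); by exists (u :: b').
exists b' => u; split=> [Pu|bu].
  have : span b (f u) by apply/bP; exists u.
  by rewrite b'E => /span_map[v bv /injf <-].
have [|v Pv /injf <-//] := (bP (f u)).2.
by rewrite -/(span _ _) b'E; apply/span_map; exists u.
Qed.

End LinearImages.

Lemma span_cat (F : fieldType) (V : lmodType F) (b b' : seq V) v :
  span (b ++ b') v <-> exists2 u, span b u & span b' (v - u).
Proof.
elim: b v => [|x b IH] v /=.
  split=> [bv|[u /span_nil ->]]; last by rewrite subr0.
  by exists 0; [apply/span_nil|rewrite subr0].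
split=> [/span_cons[a /IH[u bu b'v]]|[u /span_cons[a bu] b'v]].
  exists (u + a *: x); first by apply/span_cons; exists a; rewrite addrK.
  by rewrite opprD addrA addrAC.
apply/span_cons; exists a; apply/IH; exists (u - a *: x) => //.
by rewrite opprB addrA subrK.
Qed.

Lemma fin_dim_prod (F : fieldType) (U V : lmodType F) (P : U -> Prop)
    (Q : V -> Prop) :
  fin_dim P -> fin_dim Q -> fin_dim (fun w : U * V => P w.1 /\ Q w.2).
Proof.
have li1 : linear (fun u : U => (u, 0 : V)).
  by move=> a u v; apply: injective_projections; rewrite //= scaler0 addr0.
have li2 : linear (fun v : V => (0 : U, v)).
  by move=> a u v; apply: injective_projections; rewrite //= scaler0 addr0.
have [i1 i1E] := linear_packed li1; have [i2 i2E] := linear_packed li2.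
move=> [b bP] [b' b'Q]; exists ([seq i1 x | x <- b] ++ [seq i2 x | x <- b']).
case=> u v /=; split=> [[/bP bu /b'Q bv]|/span_cat].
  apply/span_cat; exists (i1 u); first by apply/span_map; exists u.
  apply/span_map; exists v => //; rewrite -i1E -i2E.
  by apply: injective_projections; rewrite /= ?subrr ?subr0.
move=> [_ /span_map[u' bu' <-] /span_map[v' bv']].
rewrite -i1E -i2E => uvE; have := congr1 fst uvE; have := congr1 snd uvE => /=.
rewrite subr0 => <- /esym/eqP; rewrite subr_eq0 => /eqP ->.
by split; [apply/bP|apply/b'Q].
Qed.

(** * Weight components inside an h-stable subspace *)

Section WeightSplitting.
Variables (F : fieldType) (n : nat) (g : lie_subalgebra F n) (V : lmodType F).
Variables (rho : lie_elt g -> V -> V) (rhoP : forall X, linear (rho X)).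
Implicit Types (mu : lie_elt g -> F) (s : seq V).

Definition weight_vector (w : V) : Prop :=
  exists2 lam, h_weight lam & weight_space rho lam w.

Lemma rho_sum X s : rho X (\sum_(w <- s) w) = \sum_(w <- s) rho X w.
Proof. by have [r ->] := linear_packed (rhoP X); rewrite linear_sum. Qed.

Lemma weight_space_sum mu s : (forall w, w \in s -> weight_space rho mu w) ->
  weight_space rho mu (\sum_(w <- s) w).
Proof.
move=> Hs X hX; rewrite rho_sum scaler_sumr.
by apply: eq_big_seq => w /Hs; apply.
Qed.

Variables (P : V -> Prop) (sP : subspace P).
Hypothesis stable : forall X v, in_h X -> P v -> P (rho X v).

(* The projector is a product of the operators
   (X - lam X) / (mu X - lam X), over the weights lam to be killed. *)
Lemma weight_projector mu s : (forall w, w \in s -> weight_vector w) ->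
  exists T : {linear V -> V}, [/\ forall v, P v -> P (T v),
    forall w, weight_space rho mu w -> T w = w
  & forall w, w \in s -> weight_space rho mu w \/ T w = 0].
Proof.
elim: s => [|w s IH] Hs; first by exists idfun.
have [|T [TP Tmu Ts]] := IH; first by move=> x xs; apply: Hs; rewrite inE xs orbT.
have [lam _ wlam] := Hs w (mem_head _ _).
(* Weights are functions on all of [g] but count only on h, so the test is whether [w] itself is a
   [mu]-vector. If not, some [X] in h separates [lam] from [mu]. *)
have [wmu|/existsNP[X /not_implyP[hX wX]]] := pselect (weight_space rho mu w).
  exists T; split=> // x; rewrite inE => /predU1P[->|/Ts//]; by left.
have d0 : mu X - lam X != 0.
  by apply: contra_notN wX; rewrite subr_eq0 => /eqP ->; apply: wlam.
pose R v := (mu X - lam X)^-1 *: (rho X v - lam X *: v).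
have lR : linear (T \o R).
  move=> a u v; rewrite /= -linearP; congr (T _); rewrite /R rhoP.
  rewrite [lam X *: _]scalerDr [lam X *: (a *: u)]scalerA [lam X * a]mulrC.
  rewrite -scalerA opprD addrACA -scalerBr [_^-1 *: (_ + _)]scalerDr scalerA.
  by rewrite [_^-1 * a]mulrC -scalerA.
(* [R] acts on each weight vector by a scalar, so every vector killed by [T] is still killed by
   [T \o R]. *)
have Rw x nu : weight_space rho nu x -> R x = ((nu X - lam X) / (mu X - lam X)) *: x.
  by move=> /(_ X hX) xX; rewrite /R xX -scalerBl scalerA mulrC.
have [T' T'E] := linear_packed lR; exists T'; rewrite -T'E; split=> [v Pv|x xmu|x].
- apply: TP; apply: subspaceZ => //; apply: subspaceB => //; first exact: stable.
  exact: subspaceZ.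
- by rewrite /= (Rw _ _ xmu) divff // scale1r Tmu.
rewrite inE => /predU1P[->|xs].
  by right; rewrite /= (Rw _ _ wlam) subrr mul0r scale0r linear0.
have [xmu|Tx] := Ts x xs; first by left.
have [nu _ xnu] : weight_vector x by apply: Hs; rewrite inE xs orbT.
by right; rewrite /= (Rw _ _ xnu) linearZ /= Tx scaler0.
Qed.

(** The projector for the weight of the first summand sends the total to the sum of all summands of
    that weight. Hence this sum lies in [P], so does the remainder, and induction on the number of
    summands applies. *)
Lemma weight_split s : (forall w, w \in s -> weight_vector w) ->
  P (\sum_(w <- s) w) ->
  exists s', \sum_(w <- s) w = \sum_(w <- s') w /\
    forall w, w \in s' -> P w /\ weight_vector w.
Proof.
have [m] := ubnP (size s); elim: m s => // m IH [|w s] lt Hs Pu.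
  by exists [::].
have [mu hmu wmu] := Hs w (mem_head _ _).
have [T [TP Tmu Ts]] := weight_projector mu Hs.
pose p x := `[< weight_space rho mu x >].
have TE : T (\sum_(x <- w :: s) x) = \sum_(x <- w :: s | p x) x.
  rewrite linear_sum [RHS]big_mkcond; apply: eq_big_seq => x /Ts xE.
  rewrite /p; case: asboolP => [/Tmu //|nx].
  by case: xE.
have sE : \sum_(x <- w :: s) x =
    \sum_(x <- w :: s | p x) x + \sum_(x <- w :: s | ~~ p x) x.
  exact: bigID.
have pw : p w by apply/asboolP.
have PT : P (\sum_(x <- w :: s | p x) x) by rewrite -TE; apply: TP.
have [||| s' [s'E Hs']] := IH [seq x <- w :: s | ~~ p x].
(* The remaining list is strictly shorter because [w] is itself removed from it. *)
- rewrite /= pw /= -ltnS; apply: leq_trans lt; rewrite !ltnS size_filter.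
  exact: count_size.
- by move=> x; rewrite mem_filter => /andP[_ /Hs].
- have -> : \sum_(x <- [seq x <- w :: s | ~~ p x]) x =
      \sum_(x <- w :: s) x - \sum_(x <- w :: s | p x) x.
    by rewrite sE big_filter addrC addKr.
  exact: subspaceB.
exists (\sum_(x <- w :: s | p x) x :: s'); split.
  by rewrite sE [RHS]big_cons -s'E big_filter.
move=> x; rewrite inE => /predU1P[->|/Hs'//]; split=> //.
exists mu => //; rewrite -big_filter; apply: weight_space_sum => y.
by rewrite mem_filter => /andP[/asboolP].
Qed.

End WeightSplitting.

(** * Gradings and graded maps *)

Section Gradings.
Variable F : fieldType.

Definition homogeneous (V : lmodType F) (M_ : int -> V -> Prop) (P : V -> Prop) :=
  forall s (c : int -> V), uniq s -> (forall i, M_ i (c i)) ->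
    P (\sum_(i <- s) c i) -> forall i, i \in s -> P (c i).

(** The list in [direct_sum] may repeat degrees. Merging repetitions gives components that can be
    summed over any larger duplicate-free list, so several vectors can be compared over a common
    list of degrees. *)
Lemma direct_sum_components (V : lmodType F) (M_ : int -> V -> Prop) v :
  direct_sum M_ -> exists (s : seq int) (c : int -> V), (forall i, M_ i (c i)) /\
    forall r : seq int, uniq r -> {subset s <= r} -> v = \sum_(i <- r) c i.
Proof.
move=> [sM /(_ v)[s [c [Mc vE]]] _]; exists s.
elim: s v vE => [|x s IH] v; rewrite ?big_nil ?big_cons => vE.
  exists (fun=> 0); split=> [i|r _ _]; first by case: (sM i).
  by rewrite big1.
have [d [Md dE]] := IH _ erefl.
exists (fun i => (if i == x then c x else 0) + d i); split=> [i|r ur sr].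
  apply: subspaceD => //; case: eqP => [->//|_]; by case: (sM i).
rewrite vE big_split /= -dE //; last by move=> y ys; apply: sr; rewrite inE ys orbT.
congr (_ + _); rewrite (bigD1_seq x) ?sr ?mem_head //= eqxx big1 ?addr0 //.
by move=> i /negPf->.
Qed.

Section GradedMap.
Variables (U V : lmodType F) (M_ : int -> U -> Prop) (N_ : int -> V -> Prop).
Hypotheses (dM : direct_sum M_) (dN : direct_sum N_).
Variable f : {linear U -> V}.
Hypothesis fMN : forall i u, M_ i u -> N_ i (f u).

Lemma homogeneous_ker : homogeneous M_ (fun u => f u = 0).
Proof.
move=> s c us Mc; rewrite linear_sum => fc; case: dN => _ _.
by move=> /(_ s (f \o c) us) H; apply: H => // i; apply: fMN.
Qed.

(** Strictness of graded maps: the images of the components of [u] and the given [c i] are two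
    homogeneous decompositions of [f u], so they agree. *)
Lemma component_preimage u s (c : int -> V) : uniq s -> (forall i, N_ i (c i)) ->
  f u = \sum_(i <- s) c i -> forall i, i \in s -> exists2 d, M_ i d & f d = c i.
Proof.
move=> us Nc fu i si; have [t [d [Md dE]]] := direct_sum_components u dM.
pose r := undup (s ++ t); have ur : uniq r by apply: undup_uniq.
have rs : {subset s <= r} by move=> j js; rewrite mem_undup mem_cat js.
have rt : {subset t <= r} by move=> j jt; rewrite mem_undup mem_cat jt orbT.
have [sN _ uN] := dN; exists (d i) => //; apply/eqP; rewrite -subr_eq0; apply/eqP.
(* Over the common list [r] the family [c] is cut to zero outside [s], where it does not contribute
   to [f u]. *)
have := uN r (fun j => f (d j) - (if j \in s then c j else 0)) ur.
move=> /(_ _ _ i (rs _ si)); rewrite si; apply=> [j|].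
  apply: subspaceB => //; first exact: fMN.
  by case: ifP => // _; case: (sN j).
rewrite sumrB -linear_sum -dE // fu -big_mkcond -big_filter /=.
apply/eqP; rewrite subr_eq0; apply/eqP/perm_big/uniq_perm => //.
  exact: filter_uniq.
by move=> j; rewrite mem_filter; case js: (j \in s) => //=; rewrite rs.
Qed.

Lemma homogeneous_im : homogeneous N_ (fun v => exists u, f u = v).
Proof.
by move=> s c us Nc [u /(component_preimage us Nc) cp] i /cp[d _ fd]; exists d.
Qed.

(** If [f] is injective, [d] is [u] itself; if [f] is surjective, [d] is a homogeneous
    representative. Both uses make induced maps preserve degrees. *)
Lemma graded_preimage i u : N_ i (f u) -> exists2 d, M_ i d & f d = f u.
Proof.
move=> Nfu; have [sN _ _] := dN.
have [||||d Md fd] := @component_preimage u [:: i]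
    (fun j => if j == i then f u else 0) _ _ _ i.
- by [].
- by move=> j; case: eqP => [->//|_]; case: (sN j).
- by rewrite big_seq1 eqxx.
- exact: mem_head.
by exists d => //; rewrite fd eqxx.
Qed.

End GradedMap.

Lemma direct_sum_preim (W V : lmodType F) (i : {linear W -> V})
    (M_ : int -> V -> Prop) :
  injective i -> direct_sum M_ -> homogeneous M_ (fun v => exists u, i u = v) ->
  direct_sum (fun k w => M_ k (i w)).
Proof.
move=> inji dM hi; have [sM _ uM] := dM; split=> [k|w|s c us Mc c0 k ks].
- exact: subspace_preim.
- have [s [c [Mc cE]]] := direct_sum_components (i w) dM.
  pose r := undup s; have ur : uniq r := undup_uniq s.
  have sr : {subset s <= r} by move=> j; rewrite mem_undup.
  (* Outside [r] the vector [c j] need not lie in the range of [i], hence the default 0. *)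
  have ci j : exists u, i u = (if j \in r then c j else 0).
    case: ifP => jr; last by exists 0; rewrite linear0.
    by apply: (hi r c ur Mc) => //; exists w; apply: cE.
  have [d dE] := choice ci; exists r, d; split=> [j|].
    by rewrite dE; case: ifP => // _; case: (sM j).
  apply: inji; rewrite linear_sum (cE r) //; apply: eq_big_seq => j jr.
  by rewrite dE jr.
apply: inji; rewrite linear0; apply: (uM s (i \o c) us) => //=.
by rewrite -linear_sum c0 linear0.
Qed.

Lemma direct_sum_im (V W : lmodType F) (p : {linear V -> W})
    (M_ : int -> V -> Prop) :
  (forall w, exists v, p v = w) -> direct_sum M_ ->
  homogeneous M_ (fun v => p v = 0) ->
  direct_sum (fun k w => exists2 v, M_ k v & p v = w).
Proof.
move=> surj dM hp; have [sM eM uM] := dM; split=> [k|w|s c us Mc c0 k ks].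
- exact: subspace_im.
- have [v <-] := surj w; have [s [c [Mc ->]]] := eM v.
  by exists s, (p \o c); split=> [i|]; [exists (c i)|rewrite linear_sum].
(* Independence: homogeneous lifts of the [c j] sum to an element of the kernel, and a graded kernel
   contains each of them. *)
have /choice[d dE] : forall j, exists v, M_ j v /\ p v = c j.
  by move=> j; have [v] := Mc j; exists v.
rewrite -(dE k).2; apply: (hp s d us) => // [j|]; first by case: (dE j).
by rewrite linear_sum -[RHS]c0; apply: eq_bigr => j _; case: (dE j).
Qed.

Lemma direct_sum_prod (U V : lmodType F) (M_ : int -> U -> Prop)
    (N_ : int -> V -> Prop) :
  direct_sum M_ -> direct_sum N_ ->
  direct_sum (fun k (w : U * V) => M_ k w.1 /\ N_ k w.2).
Proof.
have sum1 (r : seq int) (c : int -> U * V) :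
    \sum_(i <- r) c i = (\sum_(i <- r) (c i).1, \sum_(i <- r) (c i).2).
  elim: r => [|x r IH]; first by rewrite !big_nil.
  by rewrite !big_cons IH.
move=> dM dN; have [sM _ uM] := dM; have [sN _ uN] := dN.
split=> [k|[u v]|s c us Mc c0 k ks].
- have [[M0 MD] [N0 ND]] := (sM k, sN k); split=> // a u v [Mu Nu] [Mv Nv].
  by split; [apply: MD|apply: ND].
- have [s [c [Mc cE]]] := direct_sum_components u dM.
  have [t [d [Nd dE]]] := direct_sum_components v dN.
  exists (undup (s ++ t)), (fun i => (c i, d i)); split=> //.
  rewrite sum1 /= -cE ?undup_uniq // => [|j js]; last first.
    by rewrite mem_undup mem_cat js.
  by rewrite -dE ?undup_uniq // => j jt; rewrite mem_undup mem_cat jt orbT.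
move: c0; rewrite sum1 => /eqP; rewrite xpair_eqE => /andP[/eqP c1 /eqP c2].
apply/eqP; rewrite [c k]surjective_pairing xpair_eqE; apply/andP; split; apply/eqP.
  by apply: (uM s (fun j => (c j).1) us) => // j; case: (Mc j).
by apply: (uN s (fun j => (c j).2) us) => // j; case: (Mc j).
Qed.

End Gradings.

(** * Subspaces and quotients as vector spaces *)

Section SubAndQuotientSpaces.
Variables (F : fieldType) (V : lmodType F).

Section Types.
Variables (p : {pred V}) (cp : submod_closed p).

(* The closure proof is an argument of the predicate, hence of both types, so
   that canonical instances can be attached to them. *)
Definition submod_pred of submod_closed p : {pred V} := p.
Local Notation S := (submod_pred cp).

HB.instance Definition _ := GRing.isSubmodClosed.Build F V S cp.

Record subspace_of := SubspaceOf { subspace_val : V; _ : subspace_val \in S }.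
HB.instance Definition _ := [isSub for subspace_val].
HB.instance Definition _ := [Choice of subspace_of by <:].
HB.instance Definition _ := [SubChoice_isSubLmodule of subspace_of by <:].

Local Open Scope quotient_scope.
Definition quotient_by := Quotient.quot S.
HB.instance Definition _ := GRing.Zmodule.on quotient_by.

Definition quotient_pi : V -> quotient_by := \pi_(Quotient.quot S).

Lemma quotient_pi_eq u v : (quotient_pi u = quotient_pi v) <-> (u - v \in S).
Proof. by rewrite Quotient.idealrBE; split=> [/eqP|/eqP]. Qed.

Lemma quotient_pi_repr q : quotient_pi (repr (q : Quotient.quot S)) = q.
Proof. exact: reprK. Qed.

Lemma quotient_piD u v : quotient_pi (u + v) = quotient_pi u + quotient_pi v.
Proof. exact: (@pi_addr _ _ _ _ _ (Quotient.quot S)). Qed.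

(** The quotient is formed as an additive group, so scalars act through a representative;
    [quotient_piZ] shows that the choice does not matter. *)
Definition quotient_scale (a : F) (q : quotient_by) : quotient_by :=
  quotient_pi (a *: repr (q : Quotient.quot S)).

Lemma quotient_piZ a v : quotient_scale a (quotient_pi v) = quotient_pi (a *: v).
Proof.
by apply/quotient_pi_eq; rewrite -scalerBr rpredZ //; apply/quotient_pi_eq/reprK.
Qed.

Fact quotient_scalerA a b q :
  quotient_scale a (quotient_scale b q) = quotient_scale (a * b) q.
Proof. by rewrite -[q]quotient_pi_repr !quotient_piZ scalerA. Qed.

Fact quotient_scale1r : left_id 1 quotient_scale.
Proof. by move=> q; rewrite -[q]quotient_pi_repr quotient_piZ scale1r. Qed.

Fact quotient_scalerDr : right_distributive quotient_scale +%R.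
Proof.
move=> a q r; rewrite -[q]quotient_pi_repr -[r]quotient_pi_repr -quotient_piD.
by rewrite !quotient_piZ scalerDr quotient_piD.
Qed.

Fact quotient_scalerDl q : {morph quotient_scale^~ q : a b / a + b}.
Proof.
move=> a b; rewrite -[q]quotient_pi_repr !quotient_piZ scalerDl.
exact: quotient_piD.
Qed.

HB.instance Definition _ := GRing.Zmodule_isLmodule.Build F quotient_by
  quotient_scalerA quotient_scale1r quotient_scalerDr quotient_scalerDl.

Lemma quotient_pi_linear : linear quotient_pi.
Proof. by move=> a u v; rewrite quotient_piD -quotient_piZ. Qed.

End Types.

Lemma subspace_submod_closed (P : V -> Prop) :
  subspace P -> submod_closed [pred v | `[< P v >]].
Proof.
case=> P0 PD; split=> [|a u v]; rewrite !inE; first exact/asboolP.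
by move=> /asboolP Pu /asboolP Pv; apply/asboolP/PD.
Qed.

(** Hides the subtype: later arguments see only an injective linear map with range [P].
    [subspace_projection] does the same for the quotient. *)
Lemma subspace_inclusion (P : V -> Prop) : subspace P ->
  exists (W : lmodType F) (i : {linear W -> V}),
    injective i /\ forall v, P v <-> exists w, i w = v.
Proof.
move=> /subspace_submod_closed cP; exists (subspace_of cP : lmodType F).
have [|i iE] := @linear_packed _ (subspace_of cP) _ (@subspace_val _ cP) => //.
exists i; rewrite -iE; split=> [|v]; first exact: val_inj.
split=> [/asboolP vP|[w <-]]; first by exists (@SubspaceOf _ cP v vP).
exact/asboolP/(valP w).
Qed.

Lemma subspace_projection (P : V -> Prop) : subspace P ->
  exists (W : lmodType F) (p : {linear V -> W}),
    (forall w, exists v, p v = w) /\ forall v, P v <-> p v = 0.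
Proof.
move=> /subspace_submod_closed cP; exists (quotient_by cP : lmodType F).
have [p pE] := linear_packed (@quotient_pi_linear _ cP).
exists p; split=> [w|v].
  exists (repr (w : Quotient.quot (submod_pred cP))).
  by rewrite -pE quotient_pi_repr.
rewrite -[0](linear0 p) -pE quotient_pi_eq subr0.
by split=> [vP|/asboolP//]; apply/asboolP.
Qed.

End SubAndQuotientSpaces.

(** Ordinary choice in two arguments, which yields a whole family of operators [rho X] or [theta p]
    at once. *)
Lemma dependent_choice2 (A B C : Type) (R : A -> B -> C -> Prop) :
  (forall x y, exists z, R x y z) -> exists f, forall x y, R x y (f x y).
Proof.
by move=> H; exists (fun x y => sval (cid (H x y))) => x y; case: cid.
Qed.

(** * Submodules and quotients of Lie-Cartan modules *)

Section LieCartan.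
Variables (F : fieldType) (n : nat) (g : lie_subalgebra F n).
Implicit Types M N K : LCmodule g.

Lemma rho_linear (M : Omodule g) X : linear (@rho _ _ _ M X).
Proof. by have [_ H _] := O_action M => a u v; apply: H. Qed.

HB.instance Definition _ (M : Omodule g) X :=
  GRing.isLinear.Build F M M _ (@rho _ _ _ M X) (rho_linear X).

Lemma theta_linear M p : linear (@theta _ _ _ M p).
Proof. by have [_ H _ _] := LC_action M => a u v; apply: H. Qed.

HB.instance Definition _ M p :=
  GRing.isLinear.Build F M M _ (@theta _ _ _ M p) (theta_linear p).

Section Morphisms.
Variables (M N : LCmodule g) (f : LChom M N).

Lemma LChom_linear : linear f.
Proof. by have [] := LC_fun_O f. Qed.

HB.instance Definition _ := GRing.isLinear.Build F M N _ (LC_fun f) LChom_linear.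

Lemma LChom_grade i v : grade i v -> grade i (f v).
Proof. by have [_ H _] := LC_fun_O f; apply: H. Qed.

Lemma LChom_rho X v : f (rho X v) = rho X (f v).
Proof. by have [_ _ ->] := LC_fun_O f. Qed.

End Morphisms.

Definition LC_stable M (P : M -> Prop) : Prop :=
  [/\ subspace P, homogeneous (@grade _ _ _ M) P,
    forall X v, P v -> P (rho X v) & forall p v, P v -> P (theta p v)].

Lemma fin_dim_subspace (V : lmodType F) (P : V -> Prop) : fin_dim P -> subspace P.
Proof.
move=> [b bP]; have [b0 bD] := span_linear b; split=> [|a u v]; first exact/bP.
by move=> /bP bu /bP bv; apply/bP/bD.
Qed.

Lemma LC_submodule M (P : M -> Prop) : LC_stable P ->
  exists (K : LCmodule g) (i : LChom K M),
    injective i /\ forall v, P v <-> exists u, i u = v.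
Proof.
move=> [sP hP rP tP]; have [W [i [inji iP]]] := subspace_inclusion sP.
have Pi w : P (i w) by apply/iP; exists w.
have /dependent_choice2[r rE] : forall X w, exists w', i w' = rho X (i w).
  by move=> X w; apply/iP/rP.
have /dependent_choice2[t tE] : forall p w, exists w', i w' = theta p (i w).
  by move=> p w; apply/iP/tP.
have [r1 _ r3] := O_action M; have [t1 _ t3 t4] := LC_action M.
have r_act : lie_action r.
  split=> [a X Y v|X a u v|X Y v]; apply: inji.
  - by rewrite linearP !rE r1.
  - by rewrite linearP !rE !linearP.
  - by rewrite linearB !rE r3.
have hi : homogeneous (@grade _ _ _ M) (fun v => exists u, i u = v).
  by move=> s c us Mc /iP Ps j js; apply/iP; apply: (hP s c us Mc).
have dW : direct_sum (fun k w => grade k (i w)).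
  exact: direct_sum_preim inji (O_graded M) hi.
have fW k : fin_dim (fun w => grade k (i w)).
  by apply: fin_dim_preim => //; [case: (O_graded M)|exact: O_fin].
have degW d j X v : lie_deg d X -> grade j (i v) -> grade (d + j) (i (r X v)).
  by move=> dX jv; rewrite rE; apply: O_degree.
have lfW : locally_finite r.
  move=> v; have [U [Uv fU sU]] := O_locfin (i v).
  (* [U] need not lie in the range of [i]; its preimage is still finite-dimensional and stable. *)
  exists (fun w => U (i w)); split=> //.
    exact: fin_dim_preim inji (fin_dim_subspace fU) fU.
  by move=> X u PX Uu; rewrite rE; apply: sU.
have ssW : h_semisimple r.
  move=> v; have [s [vE sw]] := O_ss (i v).
  have [||s' [s'E s'w]] := weight_split (@rho_linear M) sP _ sw.
  - by move=> X u _; apply: rP.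
  - by rewrite -vE.
  have [s'' s''E] : exists s'', s' = [seq i x | x <- s''].
    elim: s' s'w {s'E} => [|x s' IH] s'w; first by exists [::].
    have [|s'' ->] := IH; first by move=> y ys; apply: s'w; rewrite inE ys orbT.
    have [/iP[u <-] _] := s'w x (mem_head _ _).
    by exists (u :: s'').
  exists s''; split=> [|w ws].
    by apply: inji; rewrite vE s'E s''E big_map linear_sum.
  have [|_ [lam hlam wlam]] := s'w (i w); first by rewrite s''E map_f.
  by exists lam => // X hX; apply: inji; rewrite rE linearZ; apply: wlam.
pose KO := OModule r_act dW fW degW lfW ssW.
pose t' : {mpoly F[n]} -> KO -> KO := t.
have t_act : poly_action t'.
  split=> [a p q v|p a u v|v|p q v]; apply: inji.
  - by rewrite linearP !tE t1.
  - by rewrite linearP !tE !linearP.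
  - by rewrite tE t3.
  - by rewrite !tE t4.
have t_comp X p v :
    rho X (t' p v) - t' p (rho X v) = t' (vapp (lie_val X) p) v.
  by apply: inji; rewrite linearB /= !rE !tE !rE LC_compat.
have t_deg (d : nat) j p (v : KO) :
    p \is d.-homog -> grade j v -> grade (d%:Z + j) (t' p v).
  by move=> dp jv; rewrite /= tE; apply: LC_degree.
pose K := LCModule t_act t_comp t_deg.
have iO : @O_morphism _ _ _ K M i by split=> [|//|X v]; [exact: linearP|exact: rE].
by exists K, (LCHom iO (fun p v => tE p v)).
Qed.

Lemma LC_quotient M (P : M -> Prop) : LC_stable P ->
  exists (Q : LCmodule g) (p : LChom M Q),
    (forall w, exists v, p v = w) /\ forall v, P v <-> p v = 0.
Proof.
move=> [sP hP rP tP]; have [W [p [surj pP]]] := subspace_projection sP.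
(* The value is required to match every [v] over [w], not one chosen lift, so that the operators
   obtained by choice commute with [p]. *)
have desc (T : {linear M -> M}) : (forall v, P v -> P (T v)) ->
    forall w, exists w', forall v, p v = w -> w' = p (T v).
  move=> TP w; have [v0 <-] := surj w; exists (p (T v0)) => v pv.
  apply/esym/eqP; rewrite -subr_eq0 -!linearB; apply/eqP/pP/TP/pP.
  by rewrite linearB pv subrr.
have /dependent_choice2[r rE'] := fun X => desc (rho X) (rP X).
have /dependent_choice2[t tE'] := fun q => desc (theta q) (tP q).
have rE X v : r X (p v) = p (rho X v) by apply: rE'.
have tE q v : t q (p v) = p (theta q v) by apply: tE'.
have [r1 _ r3] := O_action M; have [t1 _ t3 t4] := LC_action M.
have r_act : lie_action r.
  split=> [a X Y w|X a w w'|X Y w]; have [v <-] := surj w.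
  - by rewrite !rE r1 linearP.
  - by have [v' <-] := surj w'; rewrite -linearP !rE !linearP.
  - by rewrite !rE r3 linearB.
have dW := direct_sum_im surj (O_graded M) (fun s c us Mc Hs j js =>
  (pP _).1 (hP s c us Mc ((pP _).2 Hs) j js)).
have fW k := fin_dim_im p (O_fin M k).
have degW d j X w : lie_deg d X -> (exists2 v : M, grade j v & p v = w) ->
    exists2 v : M, grade (d + j) v & p v = r X w.
  by move=> dX [v jv <-]; exists (rho X v); rewrite ?rE //; apply: O_degree.
have lfW : locally_finite r.
  move=> w; have [v <-] := surj w; have [U [Uv fU sU]] := O_locfin v.
  exists (fun w => exists2 v, U v & p v = w); split; first by exists v.
    exact: fin_dim_im.
  by move=> X _ PX [u Uu <-]; exists (rho X u); rewrite ?rE //; apply: sU.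
have ssW : h_semisimple r.
  move=> w; have [v <-] := surj w; have [s [-> sw]] := O_ss v.
  exists [seq p x | x <- s]; split=> [|_ /mapP[x /sw[lam hlam wlam] ->]].
    by rewrite big_map linear_sum.
  by exists lam => // X hX; rewrite rE wlam // linearZ.
pose QO := OModule r_act dW fW degW lfW ssW.
pose t' : {mpoly F[n]} -> QO -> QO := t.
have t_act : poly_action t'.
  rewrite /t'; split=> [a q q' w|q a w w'|w|q q' w]; have [v <-] := surj w.
  - by rewrite !tE t1 linearP.
  - by have [v' <-] := surj w'; rewrite -linearP !tE !linearP.
  - by rewrite tE t3.
  - by rewrite !tE t4.
have t_comp X q w :
    rho X (t' q w) - t' q (rho X w) = t' (vapp (lie_val X) q) w.
  by have [v <-] := surj w; rewrite /= /t' tE !rE !tE -linearB LC_compat.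
have t_deg (d : nat) j q (w : QO) :
    q \is d.-homog -> grade j w -> grade (d%:Z + j) (t' q w).
  by move=> dq [v jv <-]; exists (theta q v); rewrite /t' ?tE //; apply: LC_degree.
pose Q := LCModule t_act t_comp t_deg.
have pO : @O_morphism _ _ _ M Q p.
  by split=> [|k v kv|X v]; [exact: linearP|exists v|rewrite /= rE].
have pt q v : p (theta q v) = @theta _ _ _ Q q (p v) by rewrite /= /t' tE.
by exists Q, (LCHom pO pt).
Qed.

(** * Zero module and direct sums *)

Lemma LC_zero_module : exists Z : LCmodule g, forall u v : Z, u = v.
Proof.
have eq0 (u v : 'rV[F]_0) : u = v by rewrite [u]thinmx0 [v]thinmx0.
(* On the zero space the identity is also the zero map, hence a Lie action. *)
pose r (X : lie_elt g) (v : 'rV[F]_0) := v.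
pose gr (i : int) (v : 'rV[F]_0) := True.
have r_act : lie_action r by split=> *; apply: eq0.
have gr_sum : direct_sum gr.
  by split=> [i|v|*]; [|exists [::], (fun=> 0); split|]; rewrite //; apply: eq0.
have fin (P : 'rV[F]_0 -> Prop) : (forall v, P v) -> fin_dim P.
  by move=> Pv; exists [::] => v; split=> // _; exists (fun=> 0); apply: eq0.
have lf : locally_finite r by move=> v; exists (fun=> True); split=> //; apply: fin.
have ss : h_semisimple r by move=> v; exists [::]; split=> //; apply: eq0.
pose ZO := @OModule _ _ g 'rV[F]_0 r gr r_act gr_sum
  (fun i => fin (gr i) (fun=> I)) (fun _ _ _ _ _ _ => I) lf ss.
pose t (p : {mpoly F[n]}) (v : ZO) := v.
have t_act : poly_action t by split=> *; apply: eq0.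
by exists (@LCModule _ _ _ ZO t t_act (fun _ _ _ => eq0 _ _) (fun _ _ _ _ _ _ => I)).
Qed.

Lemma LC_prod M N : exists K (p1 : LChom K M) (p2 : LChom K N)
    (i1 : LChom M K) (i2 : LChom N K),
  [/\ forall v, p1 (i1 v) = v, forall v, p2 (i2 v) = v,
      forall v, p1 (i2 v) = 0, forall v, p2 (i1 v) = 0
    & forall w, i1 (p1 w) + i2 (p2 w) = w].
Proof.
pose r X (w : M * N) := (rho X w.1, rho X w.2).
pose t p (w : M * N) := (theta p w.1, theta p w.2).
pose gr k (w : M * N) := grade k w.1 /\ grade k w.2.
have [r1 _ r3] := O_action M; have [t1 _ t3 t4] := LC_action M.
have [r1' _ r3'] := O_action N; have [t1' _ t3' t4'] := LC_action N.
have r_act : lie_action r.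
  split=> [a X Y v|X a u v|X Y v]; apply: injective_projections => /=;
    by rewrite ?(r1, r1', r3, r3', linearP).
have gr_sum := direct_sum_prod (O_graded M) (O_graded N).
have gr_fin k := fin_dim_prod (O_fin M k) (O_fin N k).
have gr_deg d j X w : lie_deg d X -> gr j w -> gr (d + j) (r X w).
  by move=> dX [gu gv]; split; apply: O_degree.
have r_lf : locally_finite r.
  case=> u v; have [U [Uu fU sU]] := O_locfin u.
  have [U' [Uv fU' sU']] := O_locfin v.
  exists (fun w : M * N => U w.1 /\ U' w.2); split=> //.
    exact: fin_dim_prod.
  by move=> X w PX [Uw Uw']; split; [apply: sU|apply: sU'].
have sum_prod (s : seq M) (s' : seq N) :
    \sum_(w <- [seq (x, 0) | x <- s] ++ [seq (0, x) | x <- s']) w =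
    (\sum_(x <- s) x, \sum_(x <- s') x) :> M * N.
  rewrite big_cat !big_map; apply: injective_projections => /=.
    by rewrite !raddf_sum /= [X in _ + X]big1 ?addr0.
  by rewrite !raddf_sum /= [X in X + _]big1 ?add0r.
have r_ss : h_semisimple r.
  case=> u v; have [s [uE sw]] := O_ss u; have [s' [vE sw']] := O_ss v.
  (* Padding by 0 keeps a weight vector's weight, since 0 lies in every weight space. *)
  exists ([seq (x, 0) | x <- s] ++ [seq (0, x) | x <- s']).
  split=> [|w]; first by rewrite sum_prod -uE -vE.
  rewrite mem_cat => /orP[] /mapP[x xs ->].
    have [lam hlam wlam] := sw x xs; exists lam => // X hX.
    by apply: injective_projections; rewrite /= ?linear0 ?scaler0 ?wlam.
  have [lam hlam wlam] := sw' x xs; exists lam => // X hX.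
  by apply: injective_projections; rewrite /= ?linear0 ?scaler0 ?wlam.
pose KO := OModule r_act gr_sum gr_fin gr_deg r_lf r_ss.
pose t' : {mpoly F[n]} -> KO -> KO := t.
have t_act : poly_action t'.
  split=> [a p q v|p a u v|v|p q v]; apply: injective_projections => /=;
    by rewrite ?(t1, t1', t3, t3', t4, t4', linearP).
have t_comp X p v :
    rho X (t' p v) - t' p (rho X v) = t' (vapp (lie_val X) p) v.
  by apply: injective_projections; apply: LC_compat.
have t_deg (d : nat) j p (v : KO) :
    p \is d.-homog -> grade j v -> grade (d%:Z + j) (t' p v).
  by move=> dp [gu gv]; split; apply: LC_degree.
pose K := LCModule t_act t_comp t_deg.
have p1O : @O_morphism _ _ _ K M fst by split=> // i w [].
have p2O : @O_morphism _ _ _ K N snd by split=> // i w [].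
have i1O : @O_morphism _ _ _ M K (fun v => (v, 0)).
  split=> [a u v|k v kv|X v].
  - by apply: injective_projections; rewrite //= scaler0 addr0.
  - by split=> //; have [/(_ k)[]] := O_graded N.
  - by apply: injective_projections; rewrite //= linear0.
have i2O : @O_morphism _ _ _ N K (fun v => (0, v)).
  split=> [a u v|k v kv|X v].
  - by apply: injective_projections; rewrite //= scaler0 addr0.
  - by split=> //; have [/(_ k)[]] := O_graded M.
  - by apply: injective_projections; rewrite //= linear0.
have i1t p v : (theta p v, 0) = @theta _ _ _ K p (v, 0).
  by apply: injective_projections; rewrite //= linear0.
have i2t p v : (0, theta p v) = @theta _ _ _ K p (0, v).
  by apply: injective_projections; rewrite //= linear0.
exists K, (LCHom p1O (fun _ _ => erefl)), (LCHom p2O (fun _ _ => erefl)).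
exists (LCHom i1O i1t), (LCHom i2O i2t); split=> // -[u v].
by apply: injective_projections; rewrite /= ?addr0 ?add0r.
Qed.

(** * Additive structure on morphisms *)

Section Additive.
Variables M N : LCmodule g.
Implicit Types f : LChom M N.

Lemma LCzero_O : O_morphism (fun _ : M => 0 : N).
Proof.
split=> [a u v|k v _|X v]; rewrite ?scaler0 ?addr0 ?linear0 //.
by have [/(_ k)[]] := O_graded N.
Qed.

Lemma LCzero_theta p (v : M) : 0 = theta p (0 : N).
Proof. by rewrite linear0. Qed.

Definition LCzero : LChom M N := LCHom LCzero_O LCzero_theta.

Lemma LCadd_O f f' : O_morphism (fun v => f v + f' v).
Proof.
split=> [a u v|k v kv|X v]; first by rewrite !linearP scalerDr addrACA.
  have [/(_ k) sN _ _] := O_graded N.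
  by apply: (subspaceD sN); apply: LChom_grade.
by rewrite !LChom_rho linearD.
Qed.

Lemma LCadd_theta f f' p v : f (theta p v) + f' (theta p v) = theta p (f v + f' v).
Proof. by rewrite !LC_fun_theta linearD. Qed.

Definition LCadd f f' : LChom M N := LCHom (LCadd_O f f') (LCadd_theta f f').

Lemma LCopp_O f : O_morphism (fun v => - f v).
Proof.
split=> [a u v|k v kv|X v]; first by rewrite linearP opprD scalerN.
  have [/(_ k) sN _ _] := O_graded N.
  by rewrite -scaleN1r; apply: (subspaceZ _ sN); apply: LChom_grade.
by rewrite !LChom_rho linearN.
Qed.

Lemma LCopp_theta f p v : - f (theta p v) = theta p (- f v).
Proof. by rewrite LC_fun_theta linearN. Qed.

Definition LCopp f : LChom M N := LCHom (LCopp_O f) (LCopp_theta f).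

End Additive.

(** Left transparent so that equations involving [hzero] and [hadd] reduce to pointwise ones. *)
Definition LC_preadditive : preadditive (LC g).
Proof.
exists LCadd LCzero LCopp.
- by move=> a b f f' f''; apply: LChom_eq => v /=; rewrite addrA.
- by move=> a b f f'; apply: LChom_eq => v /=; rewrite addrC.
- by move=> a b f; apply: LChom_eq => v /=; rewrite add0r.
- by move=> a b f; apply: LChom_eq => v /=; rewrite addNr.
- by move=> a b c f f' h; apply: LChom_eq.
- by move=> a b c h f f'; apply: LChom_eq => v /=; rewrite linearD.
Defined.

(** * Universal properties and the abelian axioms *)

Lemma LChom_fun_eq M N (f f' : LChom M N) v : f = f' -> f v = f' v.
Proof. by move=> ->. Qed.

(** An injective morphism reflects degrees by [graded_preimage], so the grading of [K] is the one
    induced from [M] and the lifted map respects it. *)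
Lemma LC_lift K M N (i : LChom K M) (h : LChom N M) : injective i ->
  (forall x, exists u, i u = h x) -> exists u : LChom N K, forall x, i (u x) = h x.
Proof.
move=> inji /choice[u uE].
have uO : O_morphism u.
  split=> [a v w|k v kv|X v]; first by apply: inji; rewrite uE !linearP /= !uE.
    have [|d Md /inji <- //] := graded_preimage (O_graded K) (O_graded M)
      (@LChom_grade _ _ i) (i := k) (u := u v).
    by rewrite /= uE; apply: LChom_grade.
  by apply: inji; rewrite LChom_rho !uE LChom_rho.
have ut p v : u (theta p v) = theta p (u v).
  by apply: inji; rewrite LC_fun_theta !uE LC_fun_theta.
by exists (LCHom uO ut).
Qed.

(** Dually, each homogeneous element of [Q] has a homogeneous lift of the same degree, on which [h]
    shows that [u] preserves degrees. *)
Lemma LC_factor M Q N (p : LChom M Q) (h : LChom M N) :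
  (forall w, exists v, p v = w) -> (forall v, p v = 0 -> h v = 0) ->
  exists u : LChom Q N, forall v, u (p v) = h v.
Proof.
move=> surj p0.
have /choice[u uE'] : forall w, exists x, forall v, p v = w -> x = h v.
  move=> w; have [v0 <-] := surj w; exists (h v0) => v pv.
  apply/esym/eqP; rewrite -subr_eq0 -linearB; apply/eqP/p0.
  by rewrite linearB /= pv subrr.
have uE v : u (p v) = h v by apply: uE'.
have uO : O_morphism u.
  split=> [a w w'|k w kw|X w]; have [v pv] := surj w.
  - by have [v' <-] := surj w'; rewrite -pv -linearP !uE linearP.
  - have [|d Md dv] := graded_preimage (O_graded M) (O_graded Q)
      (@LChom_grade _ _ p) (i := k) (u := v); first by rewrite /= pv.
    by rewrite -pv -dv uE; apply: LChom_grade.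
  - by rewrite -pv -LChom_rho !uE LChom_rho.
have ut q w : u (theta q w) = theta q (u w).
  by have [v <-] := surj w; rewrite -LC_fun_theta !uE LC_fun_theta.
by exists (LCHom uO ut).
Qed.

Lemma LC_is_kernel M N K (f : LChom M N) (i : LChom K M) : injective i ->
  (forall v, f v = 0 <-> exists u, i u = v) ->
  is_kernel (C := LC g) LC_preadditive f i.
Proof.
move=> inji fi; split=> [|x h fh].
  by apply: LChom_eq => v /=; apply/fi; exists v.
have [|u uE] := LC_lift (h := h) inji.
  by move=> v; apply/fi/(LChom_fun_eq v fh).
exists u; split=> [|u' u'E]; first exact: LChom_eq.
by apply: LChom_eq => v; apply: inji; rewrite uE -u'E.
Qed.

Lemma LC_is_cokernel M N Q (f : LChom M N) (p : LChom N Q) :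
  (forall w, exists v, p v = w) -> (forall v, p v = 0 <-> exists u, f u = v) ->
  is_cokernel (C := LC g) LC_preadditive f p.
Proof.
move=> surj pf; split=> [|x h hf].
  by apply: LChom_eq => v /=; apply/pf; exists v.
have [|u uE] := LC_factor (h := h) surj.
  by move=> _ /pf[v <-]; apply: (LChom_fun_eq v hf).
exists u; split=> [|u' u'E]; first exact: LChom_eq.
by apply: LChom_eq => w; have [v <-] := surj w; rewrite uE -u'E.
Qed.

Lemma LC_stable_ker M N (f : LChom M N) : LC_stable (fun v => f v = 0).
Proof.
split=> [||X v fv|p v fv].
- by split=> [|a u v fu fv]; rewrite ?linear0 // linearP /= fu fv scaler0 addr0.
- exact: (homogeneous_ker (f := f) (O_graded N) (@LChom_grade _ _ f)).
- by rewrite LChom_rho fv linear0.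
- by rewrite LC_fun_theta fv linear0.
Qed.

Lemma LC_stable_im M N (f : LChom M N) : LC_stable (fun v => exists u, f u = v).
Proof.
split=> [||X _ [u <-]|p _ [u <-]].
- split=> [|a _ _ [u <-] [v <-]]; first by exists 0; rewrite linear0.
  by exists (a *: u + v); rewrite linearP.
- exact: (homogeneous_im (f := f) (O_graded M) (O_graded N) (@LChom_grade _ _ f)).
- by exists (rho X u); rewrite LChom_rho.
- by exists (theta p u); rewrite LC_fun_theta.
Qed.

(** The inclusion of the kernel and the zero map agree after composition with [f], so the inclusion
    vanishes. *)
Lemma LC_mono_injective M N (f : LChom M N) : mono (C := LC g) f -> injective f.
Proof.
move=> mf; have [K [i [_ iP]]] := LC_submodule (LC_stable_ker f).
have i0 : i = LCzero K M.
  by apply: mf; apply: LChom_eq => v /=; rewrite linear0; apply/iP; exists v.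
move=> u v /eqP; rewrite -subr_eq0 -linearB => /eqP /iP[w].
by rewrite i0 /= => /esym/eqP; rewrite subr_eq0 => /eqP.
Qed.

(** The projection modulo the image and the zero map agree on the image, so the projection vanishes
    and the image is everything. *)
Lemma LC_epi_surjective M N (f : LChom M N) :
  epi (C := LC g) f -> forall v, exists u, f u = v.
Proof.
move=> ef v; have [Q [p [_ pP]]] := LC_quotient (LC_stable_im f).
have p0 : p = LCzero N Q.
  by apply: ef; apply: LChom_eq => u /=; apply/pP; exists u.
by apply/pP; rewrite p0.
Qed.

Lemma LC_abelian : abelian_category (LC g).
Proof.
exists LC_preadditive; split=> [|a b|a b f|a b f|a b f /LC_mono_injective fi|
    a b f /LC_epi_surjective fs].
- have [Z Z0] := LC_zero_module; exists Z => a.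
  split; [exists (LCzero a Z)|exists (LCzero Z a)]; split=> // u _;
    apply: LChom_eq => v.
    exact: Z0.
  by rewrite (Z0 v 0) !linear0.
- have [K [p1 [p2 [i1 [i2 [e11 e22 e12 e21 eD]]]]]] := LC_prod a b.
  by exists K, p1, p2, i1, i2; split; apply: LChom_eq.
- have [K [i [inji iP]]] := LC_submodule (LC_stable_ker f).
  by exists K, i; apply: LC_is_kernel.
- have [Q [p [surj pP]]] := LC_quotient (LC_stable_im f).
  by exists Q, p; apply: LC_is_cokernel => // v; rewrite pP.
(* A mono is the kernel of the projection modulo its image. *)
- have [Q [p [_ pP]]] := LC_quotient (LC_stable_im f).
  by exists Q, p; apply: LC_is_kernel => // v; rewrite pP.
(* An epi is the cokernel of the inclusion of its kernel. *)
- have [K [i [_ iP]]] := LC_submodule (LC_stable_ker f).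
  by exists K, i; apply: LC_is_cokernel.
Qed.

End LieCartan.

Theorem lemma3p7 (F : closedFieldType) (char0 : [pchar F]%R =i pred0) :
  [/\ forall n : nat, abelian_category (LC (W_alg F n)),
      forall n : nat, abelian_category (LC (S_alg F n))
    & forall r : nat, abelian_category (LC (H_alg F r))].
Proof. by split=> *; apply: LC_abelian. Qed.
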